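(* Suppose $K_m=1$ for every $m\in\mathcal M$, write $F_1=F$ for the objective of problem $\mathcal P1$ in this case, and let $\mathbf X^\ast$ be an optimal solution of $\mathcal P1$. Then the greedy algorithm described in the context returns an expert caching set $S$ that satisfies $$F_1(S)\ \ge\ \Big(1-\frac1e\Big)F_1(\mathbf X^\ast).$$
   Context: Setting. Finite nonempty sets: edge servers $\mathcal N=\{1,\dots,N\}$, users $\mathcal U$ with $|\mathcal U|=U$, models $\mathcal M$. Model $m$ has layers $\mathcal L_m$; layer $\ell$ has a finite set $\mathcal E_m^{(\ell)}$ of $E_m$ experts (all these sets are pairwise disjoint), each expert of model $m$ having size $b_m>0$. An integer $1\le K_m\le E_m$ is given and $\mathcal A_m^{(\ell)}=\{S\subseteq\mathcal E_m^{(\ell)}:|S|=K_m\}$. Server $n$ has storage capacity $Q_n\geq 0$. Each user $u$ has an associated server $n_u\in\mathcal N$ and fixed indicators $\rho_{u,i}\in\{0,1\}$ (expert $i$ is stored locally at $u$). Given probabilities: $p_{u,m}\ge0$ (user $u$ requests model $m$) and $p_{u,S}\ge 0$ for $S\in\mathcal A_m^{(\ell)}$ (user $u$ activates $S$ in layer $\ell$ of $m$). Latency constants (positive reals, independent of the caching decision): with $D_m>0$ the hidden-state size and positive link rates $R$, $T^{\rm UL}_{u,n_u,m}=D_m/R^{\rm UL}_{u,n_u}$, $T^{\rm DL}_{u,n_u,m}=D_m/R^{\rm DL}_{u,n_u}$, $T_{n,n',m}=D_m/R_{n,n'}$ ($n\ne n'$), $T_{n,{\rm C},m}=D_m/R_{n,{\rm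 C}}$, $T_{{\rm C},n,m}=D_m/R_{{\rm C},n}$ (C is the cloud, which stores all experts); computing latencies $T^{\rm CP}_{u,m}$ (user), $T^{\rm CP}_{{\rm E},m}$ (edge), $T^{\rm CP}_{{\rm C},m}$ (cloud). Caching decision: binary $\mathbf X=(x_{n,i})$, where $x_{n,i}=1$ iff server $n$ caches expert $i$. Let $E=\sum_m|\mathcal L_m|E_m$ and $V=\bigcup_{n}V_n$, $V_n=\{v_i^n: i \text{ an expert}\}$, $|V_n|=E$; $\mathbf X$ is identified with the subset $\{v_i^n:x_{n,i}=1\}\subseteq V$. Routing for user $u$ and $S\in\mathcal A_m^{(\ell)}$: each $i\in S$ is served locally if $\rho_{u,i}=1$; otherwise at $n_u$ if $x_{n_u,i}=1$; otherwise at exactly one server $n'\ne n_u$ with $x_{n',i}=1$ if such a server exists; otherwise at the cloud. Let $\beta_{u,n_u,S},\beta_{u,n',S},\beta_{u,{\rm C},S}$ be the numbers of experts of $S$ served at $n_u$, at $n'\neq n_u$, and at the cloud; the assignment to servers $n'\ne n_u$ is chosen to minimize the latency. Put $$T^{\rm OE}=\sum_{n'\ne n_u}\big[\mathbb I(\beta_{u,n',S}>0)(T_{n_u,n',m}+T^{\rm CP}_{{\rm E},m})+\beta_{u,n',S}T_{n',n_u,m}\big],$$ $$T^{\rm out}_{u,S}=T^{\rm UL}_{u,n_u,m}+\Big(K_m-\sum_{i\in S}\rho_{u,i}\Big)T^{\rm DL}_{u,n_u,m}+\mathbb I(\beta_{u,n_u,S}>0)T^{\rm CP}_{{\rm E},m}+T^{\rm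 OE}+\mathbb I(\beta_{u,{\rm C},S}>0)(T_{n_u,{\rm C},m}+T^{\rm CP}_{{\rm C},m})+\beta_{u,{\rm C},S}T_{{\rm C},n_u,m},$$ $$T^{\rm token}_{u,S}(\mathbf X)=\prod_{i\in S}\rho_{u,i}\,T^{\rm CP}_{u,m}+\Big(1-\prod_{i\in S}\rho_{u,i}\Big)T^{\rm out}_{u,S}.$$ Let $T^{\max}_{u,S}=T^{\rm token}_{u,S}(\emptyset)$ (no expert cached at any edge server) and $r_{u,S}(\mathbf X)=T^{\max}_{u,S}-T^{\rm token}_{u,S}(\mathbf X)$. The objective is $$F(\mathbf X)=\frac1U\sum_{u\in\mathcal U}\sum_{m\in\mathcal M}p_{u,m}\sum_{\ell\in\mathcal L_m}\sum_{S\in\mathcal A_m^{(\ell)}}p_{u,S}\,r_{u,S}(\mathbf X).$$ Problem $\mathcal P1$: maximize $F(\mathbf X)$ over binary $\mathbf X$ subject to $\sum_{m}\sum_{\ell}\sum_{i\in\mathcal E_m^{(\ell)}}x_{n,i}b_m\le Q_n$ for all $n\in\mathcal N$. Standing assumption (cloud access is slower than edge access): for all $m$ and all $n\ne n'$, $T_{n,n',m}+T_{n',n,m}+T^{\rm CP}_{{\rm E},m}\le T_{n,{\rm C},m}+T_{{\rm C},n,m}+T^{\rm CP}_{{\rm C},m}$, and for all $n$, $T^{\rm CP}_{{\rm E},m}\le T_{n,{\rm C},m}+T_{{\rm C},n,m}+T^{\rm CP}_{{\rm C},m}$. Greedy algorithm. For an element $z\in V$ let $b_z$ be the size of the corresponding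 expert, and $F_1(z\mid S)=F_1(S\cup\{z\})-F_1(S)$. Start with $S=\emptyset$ and $S_n=S\cap V_n=\emptyset$ for all $n$. While $V\setminus S\ne\emptyset$ and there exists $n\in\mathcal N$ with $\sum_{z\in S_n}b_z\le Q_n$: choose $(n^*,z^* )\in\arg\max_{n\in\mathcal N,\ z\in V_n\setminus S_n}F_1(z\mid S)/b_z$ (ties broken arbitrarily), and set $S:=S\cup\{z^*\}$, $S_{n^*}:=S_{n^*}\cup\{z^*\}$. Return $S=\{S_1,\dots,S_N\}$. (The loop is stated exactly as in the source; the inequality in the claim is only about the value $F_1(S)$ of the returned set.) *)

(* Defs.v *)
From HB Require Import structures.
From mathcomp Require Import all_boot all_order all_algebra.
From mathcomp Require Import reals.

Set Implicit Arguments.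
Unset Strict Implicit.
Unset Printing Implicit Defensive.

Import Order.TTheory GRing.Theory Num.Theory.
Local Open Scope ring_scope.

(* Each layer belongs to one model and each expert to one layer, so that the  *)
(* sets L_m and E_m^(l), defined below as fibres of [layer_model] and         *)
(* [expert_layer], are pairwise disjoint by construction.                     *)
Record system (R : realType) := System {
  server : finType;
  user : finType;
  model : finType;
  layer : finType;
  expert : finType;
  layer_model : layer -> model;
  expert_layer : expert -> layer;
  num_experts : model -> nat;             (* E_m *)
  num_active : model -> nat;              (* K_m *)
  expert_size : model -> R;               (* b_m *)
  capacity : server -> R;                 (* Q_n *)
  home : user -> server;                  (* n_u *)
  local : user -> expert -> bool;         (* rho_{u,i} *)
  p_model : user -> model -> R;           (* p_{u,m} *)
  (* p_{u,S}; relevant only for S in some A_m^(l), which S then determines,   *)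
  (* since it is nonempty.                                                    *)
  p_experts : user -> {set expert} -> R;
  hidden_size : model -> R;               (* D_m *)
  rate_UL : user -> server -> R;
  rate_DL : user -> server -> R;
  rate_EE : server -> server -> R;        (* R_{n,n'}, relevant for n <> n' *)
  rate_EC : server -> R;                  (* R_{n,C} *)
  rate_CE : server -> R;                  (* R_{C,n} *)
  cp_user : user -> model -> R;           (* T^CP_{u,m} *)
  cp_edge : model -> R;                   (* T^CP_{E,m} *)
  cp_cloud : model -> R                   (* T^CP_{C,m} *)
}.

Section Model.
Context {R : realType} {I : system R}.
Implicit Types (n : server I) (u : user I) (m : model I) (l : layer I).
Implicit Types (i : expert I) (S : {set expert I}).

Definition layers m : {set layer I} := [set l | layer_model l == m].

Definition experts l : {set expert I} := [set i | expert_layer i == l].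

(* A_m^(l), with m = layer_model l. *)
Definition activations l : {set {set expert I}} :=
  [set S : {set expert I} | (S \subset experts l) & (#|S| == num_active (layer_model l))].

Definition expert_model i : model I := layer_model (expert_layer i).

(* The ground set V: the element v_i^n is the pair (n, i). A caching decision *)
(* X is the set of the pairs (n, i) such that x_{n,i} = 1.                    *)
Definition ground : finType := (server I * expert I)%type.
Implicit Types (X Y : {set ground}) (z : ground).

Definition ground_at n : {set ground} := [set z | z.1 == n].

Definition size_of z : R := expert_size (expert_model z.2).

Definition T_UL u m : R := hidden_size m / rate_UL u (home u).
Definition T_DL u m : R := hidden_size m / rate_DL u (home u).
Definition T_EE n n' m : R := hidden_size m / rate_EE n n'.
Definition T_EC n m : R := hidden_size m / rate_EC n.
Definition T_CE n m : R := hidden_size m / rate_CE n.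

Definition at_home X u i : bool := ~~ local u i && ((home u, i) \in X).

Definition at_other X u i : bool :=
  [&& ~~ local u i, (home u, i) \notin X
    & [exists n, (n != home u) && ((n, i) \in X)]].

Definition at_cloud X u i : bool :=
  ~~ local u i && [forall n, (n, i) \notin X].

(* The routing decision: [a i] is the server n' <> n_u that serves expert i.  *)
(* Its value is irrelevant for the experts of S that are not [at_other].      *)
Definition assignment := {ffun expert I -> server I}.
Implicit Types a : assignment.

Definition valid_assignment X u S a : bool :=
  [forall i in S, at_other X u i ==> (a i != home u) && ((a i, i) \in X)].

Definition beta_home X u S : nat := #|[set i in S | at_home X u i]|.
Definition beta_other X u S a n : nat :=
  #|[set i in S | at_other X u i && (a i == n)]|.
Definition beta_cloud X u S : nat := #|[set i in S | at_cloud X u i]|.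

Definition T_OE X u m S a : R :=
  \sum_(n | n != home u)
    ((0 < beta_other X u S a n)%N%:R * (T_EE (home u) n m + cp_edge m)
     + (beta_other X u S a n)%:R * T_EE n (home u) m).

Definition T_out_with X u m S a : R :=
  T_UL u m
  + ((num_active m)%:R - \sum_(i in S) (local u i)%:R) * T_DL u m
  + (0 < beta_home X u S)%N%:R * cp_edge m
  + T_OE X u m S a
  + (0 < beta_cloud X u S)%N%:R * (T_EC (home u) m + cp_cloud m)
  + (beta_cloud X u S)%:R * T_CE (home u) m.

(* Some valid assignment, needed only to form the minimum below. *)
Definition some_assignment X u : assignment :=
  [ffun i => odflt (home u) [pick n | (n != home u) && ((n, i) \in X)]].

Definition best_assignment X u m S : assignment :=
  [arg min_(a < some_assignment X u | valid_assignment X u S a)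
     T_out_with X u m S a]%O.

Definition T_out X u m S : R := T_out_with X u m S (best_assignment X u m S).

Lemma some_assignment_valid X u S : valid_assignment X u S (some_assignment X u).
Proof.
apply/forall_inP => i _; apply/implyP => /and3P[_ _ /existsP[n hn]].
by rewrite ffunE; case: pickP => [n' //|/(_ n)]; rewrite hn.
Qed.

Lemma best_assignmentP X u m S :
  valid_assignment X u S (best_assignment X u m S) /\
  forall a, valid_assignment X u S a -> T_out X u m S <= T_out_with X u m S a.
Proof.
rewrite /T_out /best_assignment.
by case: arg_minP => [|a va amin]; [exact: some_assignment_valid|split].
Qed.

Definition T_token X u m S : R :=
  (\prod_(i in S) (local u i)%:R) * cp_user u m
  + (1 - \prod_(i in S) (local u i)%:R) * T_out X u m S.

Definition T_max u m S : R := T_token set0 u m S.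

Definition reduction X u m S : R := T_max u m S - T_token X u m S.

Definition objective X : R :=
  #|user I|%:R^-1 *
  \sum_u \sum_m p_model u m *
    \sum_(l in layers m) \sum_(S in activations l)
      p_experts u S * reduction X u m S.

Definition feasible X : Prop :=
  forall n, \sum_m \sum_(l in layers m) \sum_(i in experts l)
              ((n, i) \in X)%:R * expert_size m <= capacity n.

Definition optimal X : Prop :=
  feasible X /\ forall Y, feasible Y -> objective Y <= objective X.

Definition marginal z X : R := objective (z |: X) - objective X.

Definition greedy_guard X : Prop :=
  [set: ground] :\: X != set0 /\
  exists n, \sum_(z in X :&: ground_at n) size_of z <= capacity n.

Definition greedy_choice X n z : Prop :=
  z \in ground_at n :\: (X :&: ground_at n) /\
  forall n' z', z' \in ground_at n' :\: (X :&: ground_at n') ->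
    marginal z' X / size_of z' <= marginal z X / size_of z.

(* [greedy_run X Y]: the loop entered with the current set X may return Y;    *)
(* it is a relation because ties are broken arbitrarily. The sets S_n of the  *)
(* algorithm are the intersections of the current set with [ground_at n].     *)
Inductive greedy_run : {set ground} -> {set ground} -> Prop :=
| greedy_stop X : ~ greedy_guard X -> greedy_run X X
| greedy_step X Y n z :
    greedy_guard X -> greedy_choice X n z -> greedy_run (z |: X) Y ->
    greedy_run X Y.

Definition greedy_returns X : Prop := greedy_run set0 X.

End Model.

Arguments ground {R} I.

Record well_formed (R : realType) (I : system R) : Prop := WellFormed {
  server_nonempty : (0 < #|server I|)%N;
  user_nonempty : (0 < #|user I|)%N;
  model_nonempty : (0 < #|model I|)%N;
  card_experts : forall l : layer I, #|experts l| = num_experts (layer_model l);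
  num_active_bounds :
    forall m : model I, (1 <= num_active m <= num_experts m)%N;
  expert_size_gt0 : forall m : model I, 0 < expert_size m;
  capacity_ge0 : forall n : server I, 0 <= capacity n;
  p_model_prob : forall (u : user I) (m : model I), 0 <= p_model u m <= 1;
  p_experts_prob : forall (u : user I) (l : layer I) (S : {set expert I}),
    S \in activations l -> 0 <= p_experts u S <= 1;
  hidden_size_gt0 : forall m : model I, 0 < hidden_size m;
  rate_UL_gt0 : forall u : user I, 0 < rate_UL u (home u);
  rate_DL_gt0 : forall u : user I, 0 < rate_DL u (home u);
  rate_EE_gt0 : forall n n' : server I, n != n' -> 0 < rate_EE n n';
  rate_EC_gt0 : forall n : server I, 0 < rate_EC n;
  rate_CE_gt0 : forall n : server I, 0 < rate_CE n;
  cp_user_gt0 : forall (u : user I) (m : model I), 0 < cp_user u m;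
  cp_edge_gt0 : forall m : model I, 0 < cp_edge m;
  cp_cloud_gt0 : forall m : model I, 0 < cp_cloud m
}.

Definition cloud_slower (R : realType) (I : system R) : Prop :=
  (forall (m : model I) (n n' : server I), n != n' ->
     T_EE n n' m + T_EE n' n m + cp_edge m
       <= T_EC n m + T_CE n m + cp_cloud m) /\
  (forall (m : model I) (n : server I),
     cp_edge m <= T_EC n m + T_CE n m + cp_cloud m).

(* Main.v *)
Require Import Defs.
From mathcomp Require Import all_boot all_order all_algebra.
From mathcomp Require Import reals sequences exp.
From mathcomp Require Import ring lra.

Import Order.TTheory GRing.Theory Num.Theory.
Local Open Scope ring_scope.

(** When [K_m = 1], the reduction of a single expert is the largest saving
    among the servers caching it (the cloud saving being [0]), so the objective
    is a nonnegative combination of functions "maximum of the weights of the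
    elements of [X]", which are nondecreasing and submodular. Hence with [B] the
    total size of the optimum [X*], the step from [X] adding [z] gains at least
    [(b_z / B) (F X* - F X)], and the gap [F X* - F X] stays below
    [exp (- size X / B) F X*]. The loop only stops when every server is filled
    beyond its capacity, or everything is cached; either way
    the returned set is at least as large as [X*], so the gap is at most
    [F X* / e]. *)

(** * Nondecreasing submodular set functions *)

Section Submodular.
Set Implicit Arguments.
Unset Strict Implicit.
Context {R : realFieldType} {T : finType}.
Implicit Types (F G : {set T} -> R) (X Y : {set T}) (w : T -> R).

(* The second conjunct is Nemhauser and Wolsey's characterisation of           *)
(* submodularity for nondecreasing functions.                                  *)
Definition nondecreasing_submodular F : Prop :=
  (forall X Y, X \subset Y -> F X <= F Y) /\
  (forall X Y, F Y - F X <= \sum_(z in Y :\: X) (F (z |: X) - F X)).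

Lemma eq_nondecreasing_submodular F G : F =1 G ->
  nondecreasing_submodular F -> nondecreasing_submodular G.
Proof.
move=> FG [mF sF]; split=> X Y; first by rewrite -!FG; apply: mF.
by rewrite -!FG; under eq_bigr => z _ do rewrite -FG; apply: sF.
Qed.

Lemma nondecreasing_submodularZ c F : 0 <= c ->
  nondecreasing_submodular F -> nondecreasing_submodular (fun X => c * F X).
Proof.
move=> c0 [mF sF]; split=> X Y /=; first by move=> /mF; apply: ler_wpM2l.
under eq_bigr => z _ do rewrite -mulrBr.
by rewrite -mulrBr -mulr_sumr ler_wpM2l.
Qed.

Lemma nondecreasing_submodular_sum (J : finType) (P : pred J)
    (F : J -> {set T} -> R) :
  (forall j, P j -> nondecreasing_submodular (F j)) ->
  nondecreasing_submodular (fun X => \sum_(j | P j) F j X).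
Proof.
move=> sF; split=> X Y /=.
  by move=> sXY; apply: ler_sum => j /sF[mF _]; apply: mF.
under [leRHS]eq_bigr => z _ do rewrite -sumrB.
by rewrite -sumrB exchange_big; apply: ler_sum => j /sF[_]; apply.
Qed.

(** This specifies the maximum of 0 and the weights in [X] by bounds and attainment; the value 0
    covers the empty set and sets without positive weights. *)
Definition is_max_weight w F : Prop := forall X,
  [/\ 0 <= F X, forall z, z \in X -> w z <= F X
    & F X = 0 \/ exists2 z, z \in X & F X = w z].

(** If [F Y] exceeds [F X], it is the weight of some [z] in [Y :\: X], and the gain of this single
    [z] already covers the difference; otherwise nonnegativity of all gains suffices. *)
Lemma max_weight_nondecreasing_submodular w F :
  is_max_weight w F -> nondecreasing_submodular F.
Proof.
move=> wF; have mF X Y : X \subset Y -> F X <= F Y.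
  move=> /subsetP sXY; have [F0 leF _] := wF Y.
  by have [_ _ [->//|[z /sXY zY ->]]] := wF X; apply: leF.
split=> // X Y; have gain_ge0 z : 0 <= F (z |: X) - F X.
  by rewrite subr_ge0; apply/mF/subsetUr.
have [F0 leF _] := wF X.
have [FY|[z zY FY]] : F Y <= F X \/ exists2 z, z \in Y :\: X & F Y = w z.
  have [_ _ [->|[z zY ->]]] := wF Y; first by left.
  case: (boolP (z \in X)) => zX; first by left; apply: leF.
  by right; exists z => //; rewrite inE zX.
  by rewrite (@le_trans _ _ 0) ?subr_le0 ?sumr_ge0.
rewrite (bigD1 z) //= -[leLHS]addr0 lerD ?sumr_ge0 // lerD2r FY.
by have [_ leFz _] := wF (z |: X); apply/leFz/setU11.
Qed.

End Submodular.

(** * Latency reduction when a single expert is activated *)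

Section Reduction.
Set Implicit Arguments.
Unset Strict Implicit.
Context {R : realType} {I : system R}.
Implicit Types (n : server I) (u : user I) (m : model I).
Implicit Types (i : expert I) (X Y : {set ground I}).

Definition edge_cost u m n : R :=
  if n == home u then cp_edge m
  else T_EE (home u) n m + cp_edge m + T_EE n (home u) m.

Definition cloud_cost u m : R :=
  T_EC (home u) m + cp_cloud m + T_CE (home u) m.

(** The only part of the latency of a nonlocal expert [i] that depends on the caching decision. *)
Definition fetch_cost X u m i (a : assignment (I := I)) : R :=
  if (home u, i) \in X then edge_cost u m (home u)
  else if [exists n, (n, i) \in X] then edge_cost u m (a i)
  else cloud_cost u m.

Lemma card_set1_filter i (P : pred (expert I)) :
  #|[set j in [set i] | P j]| = P i.
Proof.
case: (boolP (P i)) => Pi.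
  rewrite (_ : [set _ in _ | _] = [set i]) ?cards1 //.
  by apply/setP => j; rewrite !inE; case: eqP => // ->.
by apply/eqP; rewrite cards_eq0; apply/eqP/setP => j; rewrite !inE;
  case: eqP => // ->; apply/negbTE.
Qed.

Lemma at_otherE X u i : ~~ local u i -> (home u, i) \notin X ->
  at_other X u i = [exists n, (n, i) \in X].
Proof.
move=> nl nh; rewrite /at_other nl nh /=; apply/existsP/existsP.
  by move=> [n /andP[_ h]]; exists n.
by move=> [n h]; exists n; rewrite h andbT; apply: contraNneq nh => <-.
Qed.

Lemma T_out_with_set1 X u m i a :
  num_active m = 1%N -> ~~ local u i -> valid_assignment X u [set i] a ->
  T_out_with X u m [set i] a = T_UL u m + T_DL u m + fetch_cost X u m i a.
Proof.
move=> K1 nl va.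
rewrite /T_out_with /T_OE /beta_home /beta_cloud K1 big_set1 (negbTE nl).
rewrite subr0 mul1r !card_set1_filter.
(* For one expert each count is 0 or 1, hence equal to its own positivity indicator, and the two
   terms of [T_OE] share a factor. *)
rewrite (eq_bigr (fun n => (at_other X u i && (a i == n))%:R *
    (T_EE (home u) n m + cp_edge m + T_EE n (home u) m))); last first.
  move=> n _; rewrite /beta_other card_set1_filter.
  by case: (_ && _); rewrite /= !(mul1r, mul0r, addr0).
rewrite /at_home /at_cloud nl /= /fetch_cost.
have [hh|nh] := boolP ((home u, i) \in X).
  rewrite big1 => [|n _]; last by rewrite /at_other hh andbF mul0r.
  rewrite (_ : [forall n, _] = false); last first.
    by apply/negbTE/forallPn; exists (home u); rewrite hh.
  by rewrite /edge_cost eqxx /= !(mul1r, mul0r, addr0).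
rewrite at_otherE //; have [he|ne] := boolP [exists n, (n, i) \in X].
  have /andP[ah aX] : (a i != home u) && ((a i, i) \in X).
    move/forall_inP: va => /(_ i (set11 i)) /implyP; apply.
    by rewrite at_otherE.
  rewrite (_ : [forall n, _] = false); last first.
    by apply/negbTE/forallPn; exists (a i); rewrite aX.
  rewrite (bigD1 (a i)) //= eqxx big1 => [|n /andP[_ na]]; last first.
    by rewrite eq_sym (negbTE na) mul0r.
  by rewrite /edge_cost (negbTE ah) /= !(mul1r, mul0r, addr0).
rewrite big1 => [|n _]; last by rewrite mul0r.
rewrite -negb_exists ne /cloud_cost /=.
by rewrite !(mul1r, mul0r, addr0) !addrA.
Qed.

(** The upload and download terms are the same for all assignments, so minimizing the latency
    amounts to minimizing the fetch cost. *)
Lemma T_out_set1 X u m i :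
  num_active m = 1%N -> ~~ local u i ->
  exists2 a, valid_assignment X u [set i] a &
    T_out X u m [set i] = T_UL u m + T_DL u m + fetch_cost X u m i a /\
    forall a', valid_assignment X u [set i] a' ->
      fetch_cost X u m i a <= fetch_cost X u m i a'.
Proof.
move=> K1 nl; have [va amin] := best_assignmentP X u m [set i].
exists (best_assignment X u m [set i]) => //.
have E : T_out X u m [set i] = _ := T_out_with_set1 K1 nl va.
split=> // a' va'; have := amin a' va'.
by rewrite E T_out_with_set1 // lerD2l.
Qed.

Lemma T_token_set1 X u m i : ~~ local u i ->
  T_token X u m [set i] = T_out X u m [set i].
Proof. by move=> nl; rewrite /T_token big_set1 (negbTE nl) mul0r add0r subr0 mul1r. Qed.

Lemma reduction_local X u m i : local u i -> reduction X u m [set i] = 0.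
Proof.
move=> l; rewrite /reduction /T_max /T_token big_set1 l.
by rewrite subrr !mul0r subrr.
Qed.

(** The weight of a cached pair relative to the cloud. Pairs for other experts weigh 0 and so never
    affect a maximum that is at least 0. *)
Definition saving u m i (z : ground I) : R :=
  if ~~ local u i && (z.2 == i) then cloud_cost u m - edge_cost u m z.1 else 0.

Hypotheses (hI : well_formed I) (hcloud : cloud_slower I).

Lemma edge_cost_le_cloud u m n : edge_cost u m n <= cloud_cost u m.
Proof.
have [hne hhome] := hcloud; rewrite /edge_cost /cloud_cost.
case: eqVneq => [_|nn]; first by have := hhome m (home u); lra.
by rewrite eq_sym in nn; have := hne m _ _ nn; lra.
Qed.

Lemma edge_cost_home u m n : edge_cost u m (home u) <= edge_cost u m n.
Proof.
rewrite /edge_cost eqxx; case: eqVneq => // nn.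
have D0 := hidden_size_gt0 hI m.
have h1 : 0 < T_EE (home u) n m by rewrite divr_gt0 ?(rate_EE_gt0 hI) // eq_sym.
have h2 : 0 < T_EE n (home u) m by rewrite divr_gt0 ?(rate_EE_gt0 hI).
lra.
Qed.

(** Routing always reaches a cheapest caching server: the home server beats all others because it
    needs no transfer between servers, and otherwise the assignment is a minimizer. The cloud is
    never cheaper, so the reduction is nonnegative. *)
Lemma reduction_set1_max u m i : num_active m = 1%N ->
  is_max_weight (saving u m i) (fun X => reduction X u m [set i]).
Proof.
move=> K1 X; have [l|nl] := boolP (local u i).
  rewrite reduction_local //; split=> //; last by left.
  by move=> z _; rewrite /saving l.
have [a va [Ea amin]] := T_out_set1 X K1 nl.
have [a0 _ [Ea0 _]] := T_out_set1 set0 K1 nl.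
have -> : reduction X u m [set i] = cloud_cost u m - fetch_cost X u m i a.
  rewrite /reduction /T_max !T_token_set1 // Ea Ea0 {1}/fetch_cost in_set0.
  rewrite (_ : [exists n, _] = false); first by ring.
  by apply/negbTE/existsPn => n; rewrite in_set0.
split.
- rewrite subr_ge0 /fetch_cost.
  by case: ifP => _; [|case: ifP => _]; rewrite ?edge_cost_le_cloud.
- move=> [n j] zX; rewrite /saving nl /=; case: eqP => [?|_]; last first.
    rewrite subr_ge0 /fetch_cost.
    by case: ifP => _; [|case: ifP => _]; rewrite ?edge_cost_le_cloud.
  subst j; rewrite lerD2l lerN2; have [hh|nh] := boolP ((home u, i) \in X).
    by rewrite /fetch_cost hh edge_cost_home.
  have ex : [exists n', (n', i) \in X] by apply/existsP; exists n.
  (* The constant assignment to [n] is a valid competitor: [n] caches [i], and it is not the home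
     server, which does not. *)
  apply: le_trans (amin [ffun=> n] _) _.
    apply/forall_inP => j /set1P ->; rewrite ffunE zX andbT.
    by apply/implyP => _; apply: contraNneq nh => <-.
  by rewrite /fetch_cost (negbTE nh) ex ffunE.
- rewrite /fetch_cost; have [hh|nh] := boolP ((home u, i) \in X).
    by right; exists (home u, i); rewrite // /saving nl eqxx.
  have [ex|_] := boolP [exists n, (n, i) \in X]; last by left; rewrite subrr.
  right; exists (a i, i); last by rewrite /saving nl eqxx.
  move/forall_inP: va => /(_ i (set11 i)) /implyP.
  by rewrite at_otherE // => /(_ ex) /andP[].
Qed.

Lemma objective_nondecreasing_submodular :
  (forall m, num_active m = 1%N) ->
  nondecreasing_submodular (@objective R I).
Proof.
move=> hK; apply: nondecreasing_submodularZ; first by rewrite invr_ge0.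
apply: nondecreasing_submodular_sum => u _.
apply: nondecreasing_submodular_sum => m _.
apply: nondecreasing_submodularZ; first by case/andP: (p_model_prob hI u m).
apply: nondecreasing_submodular_sum => l _.
apply: nondecreasing_submodular_sum => S Sl.
apply: nondecreasing_submodularZ.
  by case/andP: (p_experts_prob hI u Sl).
move: Sl; rewrite inE hK => /andP[_ /cards1P[i ->]].
exact: max_weight_nondecreasing_submodular (reduction_set1_max _ _ (hK m)).
Qed.

Lemma objective_set0 : objective (set0 : {set ground I}) = 0.
Proof.
rewrite /objective big1 ?mulr0 // => u _; rewrite big1 // => m _.
rewrite big1 ?mulr0 // => l _; rewrite big1 // => S _.
by rewrite /reduction /T_max subrr mulr0.
Qed.

End Reduction.

(** * Termination and approximation guarantee of the greedy algorithm *)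

Section Greedy.
Set Implicit Arguments.
Unset Strict Implicit.
Context {R : realType} {I : system R}.
Implicit Types (n : server I) (X Y : {set ground I}) (z : ground I).

Definition total_size X : R := \sum_(z in X) size_of z.

Lemma in_ground_atD n X z :
  (z \in ground_at n :\: (X :&: ground_at n)) = (z.1 == n) && (z \notin X).
Proof. by rewrite !inE; case: (z.1 == n); rewrite ?andbF ?andbT. Qed.

Lemma greedy_guardP X :
  reflect (greedy_guard X) (([set: ground I] :\: X != set0) &&
    [exists n, \sum_(z in X :&: ground_at n) size_of z <= capacity n]).
Proof.
by apply: (iffP andP) => -[h1 h2]; split=> //; apply/existsP.
Qed.

(** Each step shrinks the complement of [X], and the guard makes that complement nonempty, so a
    maximizer of the ratio exists. *)
Lemma greedy_run_exists X : exists Y, greedy_run X Y.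
Proof.
have [k] := ubnP #|~: X|; elim: k X => // k IHk X leXk.
have [guard|/greedy_stop] := greedy_guardP X; last by exists X.
have [/set0Pn[z0]] := guard; rewrite setTD inE => z0X _.
case: (@arg_maxP _ _ _ z0 [pred z | z \notin X]
  (fun z => marginal z X / size_of z) z0X) => z /= zX zmax.
have [|Y runY] := IHk (z |: X).
  rewrite -ltnS; apply: leq_trans leXk; rewrite ltnS.
  apply/proper_card/properP.
  split; last by exists z; rewrite !inE ?eqxx.
  by rewrite setCS subsetUr.
exists Y; apply: (greedy_step (n := z.1) (z := z)) => //.
split; first by rewrite in_ground_atD eqxx.
by move=> n' z'; rewrite in_ground_atD => /andP[_ /zmax].
Qed.

Lemma greedy_run_stops X Y : greedy_run X Y -> ~ greedy_guard Y.
Proof. by elim. Qed.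

Lemma total_size_server X :
  total_size X = \sum_n \sum_(z in X :&: ground_at n) size_of z.
Proof.
rewrite /total_size (partition_big (fun z => z.1) xpredT) //=.
by apply: eq_bigr => n _; apply: eq_bigl => z; rewrite !inE.
Qed.

Lemma server_sizeE X n :
  \sum_(z in X :&: ground_at n) size_of z =
  \sum_m \sum_(l in layers m) \sum_(i in experts l)
    ((n, i) \in X)%:R * expert_size m.
Proof.
transitivity (\sum_i ((n, i) \in X)%:R * expert_size (@expert_model R I i)).
  rewrite [RHS](bigID (fun i => (n, i) \in X)) /= [X in _ + X]big1 ?addr0;
    last by move=> i /negbTE ->; rewrite mul0r.
  rewrite (reindex_onto (fun i => (n, i)) (fun z : ground I => z.2)) /=.
    apply: eq_big => i; first by rewrite !inE !eqxx !andbT.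
    by rewrite !inE /= => /andP[/andP[-> _] _]; rewrite mul1r.
  by move=> [n' i]; rewrite !inE /= => /andP[_ /eqP ->].
rewrite (partition_big (@expert_model R I) xpredT) //=.
apply: eq_bigr => m _.
rewrite (partition_big (@expert_layer R I) (mem (layers m))) /=; last first.
  by move=> i; rewrite inE.
apply: eq_bigr => l; rewrite inE => /eqP lm; apply: eq_big => i.
  rewrite inE /expert_model; case: (expert_layer i =P l) => [->|_].
    by rewrite lm eqxx.
  by rewrite andbF.
by move=> /andP[/eqP -> _].
Qed.

Lemma total_size_setT_ge X : well_formed I ->
  total_size X <= total_size [set: ground I].
Proof.
move=> hI; rewrite /total_size [leRHS](bigID (mem X)) /=.
under [X in _ <= X + _]eq_bigl => z do rewrite inE.
rewrite lerDl sumr_ge0 // => z _; exact/ltW/expert_size_gt0.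
Qed.

Lemma greedy_stop_total_size X Y : well_formed I ->
  ~ greedy_guard Y -> feasible X -> total_size X <= total_size Y.
Proof.
move=> hI /greedy_guardP; rewrite negb_and negbK => /orP[|/existsPn full fX].
  rewrite setTD -setCT (inj_eq (@setC_inj _)) => /eqP -> _.
  exact: total_size_setT_ge.
rewrite !total_size_server; apply: ler_sum => n _.
rewrite server_sizeE; apply: le_trans (fX n) _.
by apply: ltW; rewrite ltNge full.
Qed.

(** Submodularity bounds the gap by the marginals of [Y :\: X], each of which is at most its size
    times the best ratio, that of [z]. *)
Lemma greedy_choice_gain X Y n z : well_formed I ->
  nondecreasing_submodular (@objective R I) -> greedy_choice X n z ->
  size_of z * (objective Y - objective X) <= total_size Y * marginal z X.
Proof.
move=> hI [mono sub] [_ zmax].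
have b0 y : 0 < @size_of R I y by apply: (expert_size_gt0 hI).
have g0 y : 0 <= marginal y X by rewrite subr_ge0; apply/mono/subsetUr.
have ratio : objective Y - objective X <=
             total_size Y * (marginal z X / size_of z).
  (* The elements of [Y] already in [X] only add nonnegative terms on the right. *)
  apply: le_trans (sub X Y) _; rewrite mulr_suml [leRHS](bigID (mem X)) /=.
  rewrite ler_wpDl ?sumr_ge0 // => [y _|].
    by rewrite mulr_ge0 ?divr_ge0 // ltW.
  under [leRHS]eq_bigl => y do rewrite andbC -in_setD.
  apply: ler_sum => y; rewrite inE => /andP[yX _].
  by rewrite mulrC -ler_pdivrMr // (zmax y.1) // in_ground_atD eqxx.
apply: le_trans (ler_wpM2l (ltW (b0 z)) ratio) _.
by rewrite mulrCA [_ * (_ / _)]mulrC divfK // gt_eqF.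
Qed.

(** A loop invariant: a step adding [z] multiplies a positive gap by at most [1 - t], hence by at
    most [expR (- t)], where [t] is [size_of z / total_size Z]. *)
Lemma greedy_run_gap X Y Z : well_formed I ->
  nondecreasing_submodular (@objective R I) ->
  0 <= objective Z -> 0 < total_size Z -> greedy_run X Y ->
  objective Z - objective X
    <= expR (- (total_size X / total_size Z)) * objective Z ->
  objective Z - objective Y
    <= expR (- (total_size Y / total_size Z)) * objective Z.
Proof.
move=> hI nsF Z0 B0; elim=> // {}X {}Y n z _ ch _ IH gap; apply: IH.
have := greedy_choice_gain Z hI nsF ch; case: ch => + _.
rewrite in_ground_atD => /andP[_ zX].
rewrite mulrC [leRHS]mulrC -ler_pdivrMr // -mulrA /marginal => gain.
rewrite {1}/total_size big_setU1 //= -/(total_size X) mulrDl opprD expRD.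
rewrite -mulrA.
(* The current set may overrun the capacities, so it may do better than [Z]; a nonpositive gap stays
   so by monotonicity. *)
have [neg|pos] := lerP (objective Z - objective X) 0.
  apply: (@le_trans _ _ 0); last by do 2![apply: mulr_ge0 => //; first exact: expR_ge0].
  by apply: le_trans neg; rewrite lerD2l lerN2; apply/nsF.1/subsetUr.
apply: (@le_trans _ _ ((1 - size_of z / total_size Z) *
                       (objective Z - objective X))); first by lra.
apply: le_trans (ler_wpM2l (expR_ge0 _) gap).
by apply: ler_wpM2r; [exact: ltW|exact: expR_ge1Dx].
Qed.

End Greedy.

Theorem proposition3 (R : realType) (I : system R)
    (hI : well_formed I) (hcloud : cloud_slower I)
    (hK : forall m : model I, num_active m = 1%N)
    (Xopt : {set ground I}) (hopt : optimal Xopt) :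
  (exists S : {set ground I}, greedy_returns S) /\
  (forall S : {set ground I}, greedy_returns S ->
     objective S >= (1 - (expR 1)^-1) * objective Xopt).
Proof.
split=> [|S run]; first exact: greedy_run_exists.
have nsF := objective_nondecreasing_submodular hI hcloud hK.
have F_ge0 X : 0 <= @objective R I X.
  by rewrite -(@objective_set0 R I); apply/nsF.1/sub0set.
(* An empty optimum is treated apart because its total size, the divisor in the exponent, would be
   0. *)
have [->|[z zopt]] := set_0Vmem Xopt; first by rewrite objective_set0 mulr0.
have b_gt0 y : 0 < @size_of R I y by apply: (expert_size_gt0 hI).
have B_gt0 : 0 < total_size Xopt.
  by rewrite /total_size (bigD1 z) //= ltr_pwDl // sumr_ge0 // => y _; apply: ltW.
have gap : objective Xopt - objective S
    <= expR (- (total_size S / total_size Xopt)) * objective Xopt.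
  apply: (greedy_run_gap hI nsF (F_ge0 _) B_gt0 run).
  by rewrite objective_set0 /total_size big_set0 mul0r oppr0 expR0 mul1r addr0.
have size_ge := greedy_stop_total_size hI (greedy_run_stops run) hopt.1.
rewrite mulrBl mul1r lerBlDr addrC -lerBlDr.
apply: le_trans gap _; apply: ler_wpM2r => //.
by rewrite -expRN ler_expR lerN2 ler_pdivlMr // mul1r.
Qed.
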